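(* Fix $u=1/2$, let $d\ge1$ and $N\ge2$ be integers, and let $q$ be the least power of two not smaller than $N$. Put $D=d+\log((1-u)^{-1})+2=d+\log 2+2$, \[ H=\max\left\{12,\ \left\lceil\frac12\log_2\frac ND\right\rceil+2\right\},\qquad k_0=\min\left\{N,\ 2\left\lceil (d+1)(1+H\log2)+\log 2\right\rceil\right\}. \] The finite-field polynomial construction over $\mathbb F_q$ with independence order $k=k_0$ uses exactly $k_0d\log_2q$ random bits, and hence \[ k_0d\log_2q=O\!\left(d^2\left(1+\log_+\frac Nd\right)\log N\right), \] with an absolute implied constant. For $N\asymp d\varepsilon^{-2}$ with $0<\varepsilon\le1$, this becomes \[ O\!\left(d^2(1+\log\varepsilon^{-1})(1+\log d+\log\varepsilon^{-1})\right), \] with an implied constant depending only on the constants in $N\asymp d\varepsilon^{-2}$.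
   Context: $\log$ denotes the natural logarithm, $\log_2$ the base-2 logarithm, and $\log_+x=\max\{0,\log x\}$. The notation $N\asymp d\varepsilon^{-2}$ means $c_1d\varepsilon^{-2}\le N\le c_2d\varepsilon^{-2}$ for some constants $0<c_1\le c_2$. Finite-field polynomial construction with independence order $k$. Let $d,N\ge1$ and $1\le k\le N$. Let $q\ge N$ be a prime power, let $\mathbb F_q$ be the field with $q$ elements, choose distinct elements $\xi_1,\ldots,\xi_N\in\mathbb F_q$, and fix a bijection $\iota:\mathbb F_q\to\{0,\ldots,q-1\}$. Choose $\boldsymbol{A}_0,\ldots,\boldsymbol{A}_{k-1}$ independently and uniformly from $\mathbb F_q^d$, and form the random vector-valued polynomial \[ \boldsymbol{F}(T)=\boldsymbol{A}_0+\boldsymbol{A}_1T+\cdots+\boldsymbol{A}_{k-1}T^{k-1}. \] For $1\le n\le N$, set $\boldsymbol{Y}_n=(Y_{n,1},\ldots,Y_{n,d})=\boldsymbol{F}(\xi_n)\in\mathbb F_q^d$ and define the grid point \[ \boldsymbol{X}_n=(X_{n,1},\ldots,X_{n,d}),\qquad X_{n,j}=\frac{\iota(Y_{n,j})}{q},\quad 1\le j\le d . \] The resulting ordered random family $(\boldsymbol{X}_1,\ldots,\boldsymbol{X}_N)$ is the finite-field polynomial construction with independence order $k$. The only randomness used by the construction is the uniform choice of the coefficients $(\boldsymbol{A}_0,\ldots,\boldsymbol{A}_{k-1})\in(\mathbb F_q^d)^k$; the number of random bits used is the number of independent fair bits needed to sample this coefficient family exactly, i.e. the base-2 logarithm of the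 number of equally likely coefficient families (an integer when $q$ is a power of two). *)

(* Defs.v *)
From HB Require Import structures.
From mathcomp Require Import all_boot all_order all_algebra.
From mathcomp Require Import reals exp.

Set Implicit Arguments.
Unset Strict Implicit.
Unset Printing Implicit Defensive.

Import Order.TTheory GRing.Theory Num.Theory.
Local Open Scope ring_scope.

Definition log2 {R : realType} (x : R) : R := ln x / ln 2.

Definition logplus {R : realType} (x : R) : R := Num.max 0 (ln x).

(* A random object produced from a uniformly distributed element of the finite
   type [seed]; no other randomness is used. *)
Record seeded (S : Type) := Seeded {
  seed : finType;
  output : seed -> S
}.

(* The base-2 logarithm of the number of equally likely outcomes of the seed. *)
Definition random_bits (R : realType) (S : Type) (X : seeded S) : R :=
  log2 (#|seed X|%:R).

(* That q is a prime power and N <= q follows from [ff_card] and [nodes_inj]. *)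
Record ff_data (N k q : nat) := FFData {
  ff : finFieldType;
  ff_card : #|ff| = q;
  nodes : 'I_N -> ff;
  nodes_inj : injective nodes;
  label : ff -> 'I_q;
  label_bij : bijective label;
  order_bounds : (0 < k <= N)%N
}.

Section Construction.
Variables (R : realType) (d N k q : nat) (P : ff_data N k q).

(* Uniform on this type = k independent uniform coefficients in F_q^d. *)
Definition coef_family : finType := {ffun 'I_k -> 'rV[ff P]_d}.

Definition vpoly_eval (A : coef_family) (t : ff P) : 'rV[ff P]_d :=
  \sum_(i < k) t ^+ i *: A i.

Definition grid_point (A : coef_family) (n : 'I_N) : 'rV[R]_d :=
  \row_(j < d) ((label (vpoly_eval A (nodes P n) 0 j))%:R / q%:R).

Definition ff_construction : seeded ('I_N -> 'rV[R]_d) := Seeded grid_point.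

End Construction.

Definition least_pow2 (N : nat) : nat := (2 ^ up_log 2 N)%N.

Definition Dpar (R : realType) (u : R) (d : nat) : R :=
  d%:R + ln ((1 - u)^-1) + 2.

(* Integer-valued: the ceiling may be negative when N is small compared to D. *)
Definition Hpar (R : realType) (d N : nat) : int :=
  Num.max 12 (Num.ceil (1 / 2 * log2 (N%:R / Dpar (1 / 2 : R) d)) + 2).

(* The absolute value only converts int to nat: the ceiling is positive since
   Hpar is at least 12. *)
Definition k0 (R : realType) (d N : nat) : nat :=
  minn N (2 * `|Num.ceil ((d.+1)%:R * (1 + (Hpar R d N)%:~R * ln 2) + ln 2
                          : R)|)%N.

(* Main.v *)
Require Import Defs.
From HB Require Import structures.
From mathcomp Require Import all_boot all_order all_algebra.
From mathcomp Require Import finfield ring lra.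
From mathcomp Require Import reals exp.

Set Implicit Arguments.
Unset Strict Implicit.
Unset Printing Implicit Defensive.

Import Order.TTheory GRing.Theory Num.Theory.
Local Open Scope ring_scope.

(** The seed of the construction is a family of k row vectors of length d over
    a field with q elements, so it takes q ^ (k * d) equally likely values and
    costs k d log_2 q bits; such a field exists because q is a power of two
    larger than 1.

    For the asymptotics, put L = logplus (N / d).  Since D >= d, the quantity
    log_2 (N / D) / 2 is at most L / (2 log 2), hence H log 2 <= 12 + L / 2 and
    k_0 is at most a constant times d (1 + L) (lemma [k0_le]).  Since q < 2 N
    and 2 <= N, the factor log_2 q is at most a constant times log N (lemma
    [log2_least_pow2_le]).  The product of these two bounds and d is the first
    estimate.

    When N <= c2 d eps^-2, taking logarithms gives
    log (N / d) <= |log c2| + 2 log eps^-1, which bounds both L and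
    log N = log d + log (N / d); substituting in the first estimate gives the
    second, with a constant that grows like (2 + |log c2|)^2. *)

Lemma ln2_gt0 (R : realType) : 0 < ln 2 :> R.
Proof. by apply: ln_gt0; rewrite ltr1n. Qed.

Lemma ln2_le1 (R : realType) : ln 2 <= 1 :> R.
Proof. by apply: le_ln1Dx; lra. Qed.

Lemma logplus_ge0 (R : realType) (x : R) : 0 <= logplus x.
Proof. by rewrite /logplus le_max lexx. Qed.

Lemma ln_le_logplus (R : realType) (x : R) : ln x <= logplus x.
Proof. by rewrite /logplus le_max lexx orbT. Qed.

(** * The number of random bits *)

Lemma random_bits_ff_construction (R : realType) (d N k q : nat)
    (P : ff_data N k q) :
  random_bits R (ff_construction R d P) = k%:R * d%:R * log2 q%:R.
Proof.
have q_gt0 : (0 < q)%N by rewrite -(ff_card P); apply/card_gt0P; exists 0.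
rewrite /random_bits /ff_construction /= /coef_family card_ffun card_mx.
rewrite card_ord (ff_card P) mul1n -expnM natrX /log2.
by rewrite lnXn ?ltr0n// -[ln _ *+ _]mulr_natl natrM mulrA [d%:R * _]mulrC.
Qed.

(** The enumeration of a field with 2 ^ m elements provides both the labelling
    and, through its first N values, the nodes. *)
Lemma ff_data_pow2 (N k m : nat) :
  (0 < m)%N -> (N <= 2 ^ m)%N -> (0 < k <= N)%N ->
  inhabited (ff_data N k (2 ^ m)).
Proof.
move=> m_gt0 leN kN.
have [F _ cardF] := pPrimePowerField (isT : prime 2) m_gt0.
have leNF : (N <= #|F|)%N by rewrite cardF.
constructor; apply: (@FFData N k _ F cardF
  (fun i => enum_val (widen_ord leNF i)) _
  (fun x => cast_ord cardF (enum_rank x)) _ kN).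
  by move=> i j /enum_val_inj/(congr1 val)/= /val_inj.
exists (fun i => enum_val (cast_ord (esym cardF) i)) => x.
  by rewrite cast_ordK enum_rankK.
by rewrite enum_valK cast_ordKV.
Qed.

(** * Size of the independence order *)

Lemma Dpar_half (R : realType) (d : nat) :
  Dpar (1 / 2 : R) d = d%:R + ln 2 + 2.
Proof.
by rewrite /Dpar; have -> : (1 - 1 / 2 : R)^-1 = 2 by field.
Qed.

(** Replacing D by the smaller d and log by log_+ only enlarges the bound, and
    makes it nonnegative, so that it can be added to the constant 12. *)
Lemma ln_div_Dpar_le (R : realType) (d N : nat) : (0 < d)%N -> (0 < N)%N ->
  ln (N%:R / Dpar (1 / 2 : R) d) <= logplus (N%:R / d%:R).
Proof.
move=> d_gt0 N_gt0; apply: le_trans (ln_le_logplus _).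
have a_gt0 := ln2_gt0 R.
have d_gt0R : 0 < d%:R :> R by rewrite ltr0n.
have N_gt0R : 0 < N%:R :> R by rewrite ltr0n.
have ledD : d%:R <= Dpar (1 / 2 : R) d by rewrite Dpar_half; lra.
have D_gt0 := lt_le_trans d_gt0R ledD.
rewrite ler_ln ?posrE ?divr_gt0//.
by rewrite ler_pM2l// lef_pV2.
Qed.

(** The product with log 2 turns log_2 (N / D) / 2 into log (N / D) / 2.  The
    constant 12 covers both entries of the maximum: 12 log 2 <= 12, and the
    ceiling contributes at most 3 log 2. *)
Lemma Hpar_ln2_le (R : realType) (d N : nat) : (0 < d)%N -> (0 < N)%N ->
  (Hpar R d N)%:~R * ln 2 <= 12 + logplus (N%:R / d%:R) / 2 :> R.
Proof.
move=> d_gt0 N_gt0; have a_gt0 := ln2_gt0 R; have a_le1 := ln2_le1 R.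
have lnL := @ln_div_Dpar_le R d N d_gt0 N_gt0.
have L_ge0 := logplus_ge0 (N%:R / d%:R : R).
rewrite /Hpar; set y : R := 1 / 2 * log2 _.
have y_ln2 : y * ln 2 = ln (N%:R / Dpar (1 / 2 : R) d) / 2.
  by rewrite /y /log2; field; rewrite gt_eqF.
have [_|_] := leP (12 : int) (Num.ceil y + 2); last first.
  have -> : (12 : int)%:~R = 12 :> R by [].
  lra.
have := ceilB1_lt y; rewrite intrB intrD => ceil_lt.
have : ((Num.ceil y)%:~R - 1) * ln 2 <= y * ln 2.
  by rewrite ler_wpM2r ?ltW.
have -> : (2 : int)%:~R = 2 :> R by [].
rewrite y_ln2; nra.
Qed.

Lemma Hpar_gt0 (R : realType) (d N : nat) : 0 < Hpar R d N.
Proof. by rewrite /Hpar lt_max. Qed.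

Lemma ceil_order_gt0 (R : realType) (d N : nat) :
  0 < Num.ceil ((d.+1)%:R * (1 + (Hpar R d N)%:~R * ln 2) + ln 2 : R).
Proof.
rewrite ltNge ceil_le0 -ltNge addr_gt0 ?ln2_gt0// mulr_gt0 ?ltr0n//.
by rewrite addr_gt0// mulr_gt0 ?ln2_gt0// ltr0z Hpar_gt0.
Qed.

Lemma k0_bounds (R : realType) (d N : nat) :
  (0 < N)%N -> (0 < k0 R d N <= N)%N.
Proof.
move=> N_gt0; rewrite /k0 geq_minl andbT leq_min N_gt0 muln_gt0 /=.
by rewrite absz_gt0 gt_eqF// ceil_order_gt0.
Qed.

(** Bounding the minimum that defines k_0 by N would give a factor N / d in
    place of 1 + L, so the bound comes from the ceiling:
    (d + 1) (1 + H log 2) + log 2 <= 2 d (13 + L / 2) + 1, the ceiling adds at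
    most 1, and 2 (26 d + d L + 2) <= 56 d (1 + L) because 1 <= d. *)
Lemma k0_le (R : realType) (d N : nat) : (0 < d)%N -> (0 < N)%N ->
  (k0 R d N)%:R <= 56 * (d%:R * (1 + logplus (N%:R / d%:R))) :> R.
Proof.
move=> d_gt0 N_gt0; have a_le1 := ln2_le1 R.
have H_le := @Hpar_ln2_le R d N d_gt0 N_gt0.
have := logplus_ge0 (N%:R / d%:R : R).
move: H_le; set L := logplus _; set h := _ * ln 2 => H_le L_ge0.
have d_ge1 : 1 <= d%:R :> R by rewrite ler1n.
set x : R := d.+1%:R * (1 + h) + ln 2.
have ceil_gt0 : 0 < Num.ceil x := ceil_order_gt0 R d N.
have ceil_lt : (Num.ceil x)%:~R < x + 1.
  by have := ceilB1_lt x; rewrite intrB ltrBlDr.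
have x_le : x <= 2 * d%:R * (13 + L / 2) + 1.
  rewrite /x -natr1 lerD// (le_trans (ler_wpM2l _ (_ : 1 + h <= 13 + L / 2)))//;
    first lra; [lra|].
  by rewrite ler_wpM2r; lra.
have k0_le_ceil : (k0 R d N)%:R <= 2 * (Num.ceil x)%:~R :> R.
  rewrite (le_trans (_ : _ <= (2 * `|Num.ceil x|)%N%:R))//.
    by rewrite ler_nat geq_minr.
  by rewrite natrM natr_absz gtr0_norm.
have dL_ge0 : 0 <= d%:R * L by rewrite mulr_ge0 ?ler0n.
rewrite mulrDr mulr1; lra.
Qed.

(** * Asymptotic estimates *)

(** Minimality of q gives q / 2 < N, hence q <= 2 N <= N ^ 2; this is where
    2 <= N enters, as log N must absorb the rounding up. *)
Lemma log2_least_pow2_le (R : realType) (N : nat) : (2 <= N)%N ->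
  log2 (least_pow2 N)%:R <= 2 / ln 2 * ln N%:R :> R.
Proof.
move=> N_ge2; have m_gt0 : (0 < up_log 2 N)%N by rewrite up_log_gt0.
have q_le : (least_pow2 N <= N ^ 2)%N.
  rewrite /least_pow2 -(prednK m_gt0) expnS expnS expn1.
  by rewrite leq_mul// ltnW// up_log_gtn.
have N_gt0 : 0 < N%:R :> R by rewrite ltr0n (leq_trans _ N_ge2).
rewrite /log2 mulrAC ler_wpM2r ?invr_ge0 ?(ltW (ln2_gt0 R))//.
rewrite mulr_natl -lnXn// -natrX ler_ln ?posrE ?ltr0n ?ler_nat//.
  by rewrite expn_gt0.
by rewrite expn_gt0 (leq_trans _ N_ge2).
Qed.

(** The constant is 112 / log 2 = 56 * (2 / log 2), from [k0_le] and
    [log2_least_pow2_le]. *)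
Lemma bits_le (R : realType) (d N : nat) : (1 <= d)%N -> (2 <= N)%N ->
  (k0 R d N)%:R * d%:R * log2 (least_pow2 N)%:R
    <= 112 / ln 2 * (d%:R ^+ 2 * (1 + logplus (N%:R / d%:R)) * ln N%:R) :> R.
Proof.
move=> d_gt0 N_ge2; have N_gt0 := leq_trans (isT : (0 < 2)%N) N_ge2.
have q_ge1 : (1 <= least_pow2 N)%N by rewrite expn_gt0.
have -> : 112 / ln 2 * (d%:R ^+ 2 * (1 + logplus (N%:R / d%:R)) * ln N%:R)
    = 56 * (d%:R * (1 + logplus (N%:R / d%:R))) * d%:R
      * (2 / ln 2 * ln N%:R) :> R.
  by have := ln2_gt0 R => a_gt0; field; rewrite gt_eqF.
have log2q_ge0 : 0 <= log2 (least_pow2 N)%:R :> R.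
  by rewrite divr_ge0 ?ln_ge0 ?ler1n// ltW ?ln2_gt0.
rewrite ler_pM ?log2_least_pow2_le//; first by rewrite mulr_ge0 ?ler0n.
by rewrite ler_wpM2r ?ler0n ?k0_le.
Qed.

(** The absolute value makes the right-hand side nonnegative for every c once
    eps <= 1, so that it also bounds the positive part of the logarithm. *)
Lemma ln_ratio_le (R : realType) (c x y eps : R) : 0 < c -> 0 < x -> 0 < y ->
  0 < eps -> y <= c * x * eps ^- 2 -> ln (y / x) <= `|ln c| + 2 * ln eps^-1.
Proof.
move=> c_gt0 x_gt0 y_gt0 eps_gt0 y_le.
have e_gt0 : 0 < eps^-1 by rewrite invr_gt0.
have : y / x <= c * eps^-1 ^+ 2.
  by rewrite ler_pdivrMr// exprVn mulrAC.
rewrite -ler_ln ?posrE ?divr_gt0 ?mulr_gt0 ?exprn_gt0//.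
rewrite [leRHS]lnM ?posrE ?exprn_gt0//.
rewrite lnXn// -[_ *+ 2]mulr_natl => /le_trans; apply.
by rewrite lerD2r ler_norm.
Qed.

Theorem corollary4p5 (R : realType) :
  let bits (d N : nat) : R :=
    (k0 R d N)%:R * d%:R * log2 (least_pow2 N)%:R in
  [/\ (forall d N : nat, (1 <= d)%N -> (2 <= N)%N ->
        [/\ Dpar (1 / 2 : R) d = d%:R + ln 2 + 2,
            inhabited (ff_data N (k0 R d N) (least_pow2 N)) &
            forall P : ff_data N (k0 R d N) (least_pow2 N),
              random_bits R (ff_construction R d P) = bits d N]),
      (exists2 C : R, 0 < C &
        forall d N : nat, (1 <= d)%N -> (2 <= N)%N ->
          bits d N
            <= C * (d%:R ^+ 2 * (1 + logplus (N%:R / d%:R)) * ln N%:R)) &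
      (forall c1 c2 : R, 0 < c1 -> c1 <= c2 ->
        exists2 C : R, 0 < C &
          forall (d N : nat) (eps : R), (1 <= d)%N -> (2 <= N)%N ->
            0 < eps -> eps <= 1 ->
            c1 * d%:R * eps ^- 2 <= N%:R -> N%:R <= c2 * d%:R * eps ^- 2 ->
            bits d N
              <= C * (d%:R ^+ 2 * (1 + ln eps^-1)
                      * (1 + ln d%:R + ln eps^-1)))].
Proof.
move=> bits; split=> [d N d_gt0 N_ge2||c1 c2 c1_gt0 c12].
- have N_gt0 := leq_trans (isT : (0 < 2)%N) N_ge2.
  split=> [||P]; [exact: Dpar_half| |exact: random_bits_ff_construction].
  by apply: ff_data_pow2; rewrite ?up_log_gt0 ?up_logP ?k0_bounds.
- exists (112 / ln 2); first by rewrite divr_gt0 ?ln2_gt0.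
  exact: bits_le.
have c2_gt0 := lt_le_trans c1_gt0 c12; set a := `|ln c2|.
have a_ge0 : 0 <= a by rewrite normr_ge0.
have K_gt0 : 0 < 112 / ln 2 :> R by rewrite divr_gt0 ?ln2_gt0.
(* One factor 2 + a pays for 1 + logplus (N / d), the other for ln N. *)
exists (112 / ln 2 * (2 + a) ^+ 2).
  by rewrite mulr_gt0// exprn_gt0//; lra.
move=> d N eps d_gt0 N_ge2 eps_gt0 eps_le1 _ N_le.
have d_gt0R : 0 < d%:R :> R by rewrite ltr0n.
have N_gt0R : 0 < N%:R :> R by rewrite ltr0n (leq_trans _ N_ge2).
have ratio_le := ln_ratio_le c2_gt0 d_gt0R N_gt0R eps_gt0 N_le.
have E_ge0 : 0 <= ln eps^-1 by rewrite ln_ge0// invf_ge1.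
have ld_ge0 : 0 <= ln d%:R :> R by rewrite ln_ge0// ler1n.
have lnN : ln N%:R = ln (N%:R / d%:R) + ln d%:R :> R.
  by rewrite ln_div ?posrE// subrK.
have lnN_ge0 : 0 <= ln N%:R :> R by rewrite ln_ge0// ler1n (leq_trans _ N_ge2).
move: ratio_le lnN E_ge0 ld_ge0; rewrite -/a.
set E := ln eps^-1; set l := ln d%:R => ratio_le lnN E_ge0 ld_ge0.
have aE_ge0 : 0 <= a * E by rewrite mulr_ge0.
have al_ge0 : 0 <= a * l by rewrite mulr_ge0.
have L_le : 1 + logplus (N%:R / d%:R) <= (2 + a) * (1 + E).
  have : logplus (N%:R / d%:R) <= a + 2 * E by rewrite ge_max ratio_le andbT; lra.
  lra.
have lnN_le : ln N%:R <= (2 + a) * (1 + l + E) by lra.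
apply: le_trans (bits_le R d_gt0 N_ge2) _.
rewrite -[leRHS]mulrA ler_pM2l//.
have -> : (2 + a) ^+ 2 * (d%:R ^+ 2 * (1 + E) * (1 + l + E))
    = d%:R ^+ 2 * ((2 + a) * (1 + E)) * ((2 + a) * (1 + l + E)) by ring.
rewrite ler_pM ?mulr_ge0 ?exprn_ge0 ?ler0n ?addr_ge0 ?logplus_ge0//.
by rewrite ler_wpM2l ?exprn_ge0 ?ler0n.
Qed.
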